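(* Let $\lambda$ be a nonzero real number and let $\phi_{n,\lambda}(x)$ ($n\ge 0$) be the degenerate Bell polynomials. Then for every integer $n\ge 0$, $$\phi_{n+1,\lambda}(x)=x\sum_{k=0}^{n}\binom{n}{k}(-1)^{n-k}\langle \lambda\rangle_{n-k,\lambda}\Big(\phi_{k,\lambda}^{\prime}(x)+\phi_{k,\lambda}(x)\Big),$$ where $\phi_{k,\lambda}^{\prime}(x)=\frac{d}{dx}\phi_{k,\lambda}(x)$.
   Context: For a nonzero real number $\lambda$: generalized falling factorials $(x)_{0,\lambda}=1$, $(x)_{n,\lambda}=x(x-\lambda)\cdots(x-(n-1)\lambda)$ for $n\ge 1$; generalized rising factorials $\langle x\rangle_{0,\lambda}=1$, $\langle x\rangle_{n,\lambda}=x(x+\lambda)\cdots(x+(n-1)\lambda)$ for $n\ge 1$. With $(x)_0=1$ and $(x)_n=x(x-1)\cdots(x-n+1)$ for $n\ge 1$, the degenerate Stirling numbers of the second kind ${n \brace k}_{\lambda}$ ($0\le k\le n$) are defined by the polynomial identity $(x)_{n,\lambda}=\sum_{k=0}^{n}{n \brace k}_{\lambda}(x)_{k}$, $n\ge 0$. The degenerate Bell polynomials are $\phi_{n,\lambda}(x)=\sum_{k=0}^{n}{n \brace k}_{\lambda}x^{k}$. *)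

(* Defs.v *)
From mathcomp Require Import all_boot all_order all_algebra.
From mathcomp Require Import boolp reals.

Set Implicit Arguments.
Unset Strict Implicit.
Unset Printing Implicit Defensive.

Import Order.TTheory GRing.Theory Num.Theory.
Local Open Scope ring_scope.

(* These are taken over an arbitrary commutative ring so that [x] can be either
   a real number or the indeterminate ['X] (with [lam] embedded as [lam%:P]). *)
Definition gen_falling (A : comNzRingType) (lam x : A) (n : nat) : A :=
  \prod_(i < n) (x - i%:R * lam).

Definition gen_rising (A : comNzRingType) (lam x : A) (n : nat) : A :=
  \prod_(i < n) (x + i%:R * lam).

Definition falling (A : comNzRingType) (x : A) (n : nat) : A :=
  \prod_(i < n) (x - i%:R).

(* The values at k > n, which the polynomial identity does not mention, are
   set to 0; the family [S] is then unique. *)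
Definition is_deg_stirling2 (R : realType) (lam : R) (S : nat -> nat -> R) :=
  (forall n, gen_falling lam%:P 'X n =
             \sum_(k < n.+1) S n k *: falling ('X : {poly R}) k)
  /\ (forall n k, (n < k)%N -> S n k = 0).

Lemma ex_deg_stirling2 (R : realType) (lam : R) :
  exists S, is_deg_stirling2 lam S.
Proof.
pose step n (s : nat -> R) k :=
  (if k is j.+1 then s j else 0) + (k%:R - n%:R * lam) * s k.
pose S := fix S n := if n is m.+1 then step m (S m)
                     else fun k => (k == 0%N)%:R.
have Sgt n k : (n < k)%N -> S n k = 0.
  elim: n k => [|n IHn] [|k] //= lt_nk.
  by rewrite /step !IHn ?mulr0 ?addr0 // ltnW.
exists S; split=> //; elim=> [|n IHn].
  by rewrite /gen_falling /falling big_ord_recl !big_ord0 scale1r addr0.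
rewrite /gen_falling big_ord_recr /= -/(gen_falling _ _ n) IHn.
have -> : \sum_(k < n.+2) step n (S n) k *: falling ('X : {poly R}) k =
    \sum_(k < n.+1) S n k *: falling 'X k.+1 +
    \sum_(k < n.+1) ((k%:R - n%:R * lam) * S n k) *: falling 'X k.
  under eq_bigr do rewrite scalerDl.
  rewrite big_split /=; congr (_ + _).
    by rewrite big_ord_recl /= scale0r add0r.
  by rewrite big_ord_recr /= Sgt // mulr0 scale0r addr0.
rewrite -big_split mulr_suml /=; apply: eq_bigr => k _.
rewrite {2}/falling big_ord_recr /= -/(falling _ k).
rewrite [_ * S n k]mulrC -scalerA -scalerDr -scalerAl; congr (_ *: _).
rewrite -mul_polyC [_%:P * falling _ _]mulrC -mulrDr; congr (_ * _).
by rewrite polyCB polyCM !polyC_natr addrA subrK.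
Qed.

Definition deg_stirling2 (R : realType) (lam : R) : nat -> nat -> R :=
  sval (cid (ex_deg_stirling2 lam)).

Lemma deg_stirling2P (R : realType) (lam : R) :
  is_deg_stirling2 lam (deg_stirling2 lam).
Proof. exact: (svalP (cid (ex_deg_stirling2 lam))). Qed.

Lemma falling_free (R : realType) (n : nat) (c : nat -> R) :
  \sum_(k < n) c k *: falling ('X : {poly R}) k = 0 ->
  forall k, (k < n)%N -> c k = 0.
Proof.
have fE k : falling ('X : {poly R}) k = \prod_(i < k) ('X - (i%:R)%:P).
  by apply: eq_bigr => i _; rewrite polyC_natr.
have szf k : size (falling ('X : {poly R}) k) = k.+1.
  by rewrite fE size_prod_XsubC /index_enum -enumT size_enum_ord.
elim: n => [|n IHn] // s0 k.
have cn0 : c n = 0.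
  move/(congr1 (fun p : {poly R} => p`_n)): s0.
  rewrite coef0 big_ord_recr /= coefD coef_sum big1 => [|i _]; last first.
    by rewrite coefZ nth_default ?mulr0 // szf.
  rewrite add0r coefZ; have /monicP : falling ('X : {poly R}) n \is monic.
    by rewrite fE monic_prod_XsubC.
  by rewrite lead_coefE szf /= => ->; rewrite mulr1.
rewrite ltnS leq_eqVlt => /predU1P[-> //|lt_kn]; apply: IHn => //.
by move: s0; rewrite big_ord_recr /= cn0 scale0r addr0.
Qed.

Lemma deg_stirling2_uniq (R : realType) (lam : R) (S : nat -> nat -> R) :
  is_deg_stirling2 lam S -> forall n k, S n k = deg_stirling2 lam n k.
Proof.
have [T1 T2] := deg_stirling2P lam; move=> [S1 S2] n k.
have [lt_nk|le_kn] := ltnP n k; first by rewrite S2 ?T2.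
apply/eqP; rewrite -subr_eq0; apply/eqP.
apply: (@falling_free _ n.+1 (fun j => S n j - deg_stirling2 lam n j)) => //.
under eq_bigr do rewrite scalerBl.
by rewrite sumrB -S1 -T1 subrr.
Qed.

Definition deg_bell (R : realType) (lam : R) (n : nat) : {poly R} :=
  \sum_(k < n.+1) deg_stirling2 lam n k *: 'X^k.

(* Main.v *)
Require Import Defs.
From mathcomp Require Import all_boot all_order all_algebra.
From mathcomp Require Import reals.
From mathcomp Require Import ring.

(** Multiplying [gen_falling lam 'X n] by ['X - n lam] and re-expanding in
    falling factorials, through ['X * falling 'X k = falling 'X k.+1 +
    k * falling 'X k], gives the triangular recurrence of the degenerate
    Stirling numbers.  Read on generating polynomials it is
    [phi_(n+1) = 'X (phi_n' + phi_n) - n lam phi_n] ([deg_bellS]).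

    Since [gen_rising lam lam m = m! lam^m], the coefficients
    [a n k = 'C(n, k) (-1)^(n-k) gen_rising lam lam (n-k)] satisfy [a n n = 1] and [a n.+1 k = - (n + 1) lam a n k] for
    [k <= n] ([bell_weightS]).  The right-hand side [T n] therefore obeys
    [T n.+1 = 'X (phi_(n+1)' + phi_(n+1)) - (n + 1) lam T n]; if [T n] is
    [phi_(n+1)], this is the recurrence above for [phi_(n+2)], whence the
    theorem by induction on [n]. *)

Set Implicit Arguments.
Unset Strict Implicit.
Unset Printing Implicit Defensive.

Import Order.TTheory GRing.Theory Num.Theory.
Local Open Scope ring_scope.

Lemma gen_fallingS (A : comNzRingType) (lam x : A) n :
  gen_falling lam x n.+1 = gen_falling lam x n * (x - n%:R * lam).
Proof. by rewrite /gen_falling big_ord_recr. Qed.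

Lemma fallingS (A : comNzRingType) (x : A) n :
  falling x n.+1 = falling x n * (x - n%:R).
Proof. by rewrite /falling big_ord_recr. Qed.

Lemma gen_rising_diag (A : comNzRingType) (lam : A) n :
  gen_rising lam lam n = n`!%:R * lam ^+ n.
Proof.
elim: n => [|n IHn]; first by rewrite /gen_rising big_ord0 mulr1.
rewrite /gen_rising big_ord_recr /= -/(gen_rising _ _ n) IHn factS natrM exprS.
by rewrite -natr1; ring.
Qed.

(** At [k = 0] the factor [(0 < k)%:R] discards the first term, where [k.-1]
    is [0] instead of [-1]. *)
Lemma deg_stirling2S (R : realType) (lam : R) n k :
  deg_stirling2 lam n.+1 k =
  (0 < k)%:R * deg_stirling2 lam n k.-1 +
  (k%:R - n%:R * lam) * deg_stirling2 lam n k.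
Proof.
have [expand S0] := deg_stirling2P lam; set S := deg_stirling2 lam in expand S0 *.
have [lt_nk|le_kn] := ltnP n.+1 k.
  by case: k lt_nk => // k lt_nk; rewrite !S0 ?mulr0 ?addr0 // ltnW.
apply/eqP; rewrite -subr_eq0; apply/eqP.
(* Both sides of the recurrence are coefficients of [gen_falling lam 'X n.+1]
   in the basis of falling factorials. *)
apply: (@falling_free _ n.+2 (fun j => S n.+1 j -
  ((0 < j)%:R * S n j.-1 + (j%:R - n%:R * lam) * S n j))) => //.
under eq_bigr do rewrite scalerBl scalerDl.
rewrite sumrB -expand big_split /=.
rewrite big_ord_recl /= mul0r scale0r add0r.
rewrite [X in _ - (_ + X)]big_ord_recr /= S0 // mulr0 scale0r addr0.
rewrite -big_split gen_fallingS expand mulr_suml -sumrB /=.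
apply: big1 => k' _; rewrite mul1r fallingS -!mul_polyC.
by rewrite polyCM polyCB polyCM !polyC_natr; ring.
Qed.

Lemma coef_deg_bell (R : realType) (lam : R) n k :
  (deg_bell lam n)`_k = deg_stirling2 lam n k.
Proof.
rewrite /deg_bell -poly_def coef_poly; case: ltnP => // lt_nk.
by have [_ ->] := deg_stirling2P lam.
Qed.

Lemma deg_bellS (R : realType) (lam : R) n :
  deg_bell lam n.+1 =
  'X * ((deg_bell lam n)^`() + deg_bell lam n) - (n%:R * lam) *: deg_bell lam n.
Proof.
apply/polyP => k; rewrite coefB coefZ coefXM coefD coef_deriv !coef_deg_bell.
rewrite deg_stirling2S; case: k => [|k] /=; first by ring.
by rewrite -mulr_natr; ring.
Qed.

(** The coefficient of [phi_k' + phi_k] in the expansion of [phi_(n+1)]. *)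
Definition bell_weight (A : comNzRingType) (lam : A) n k : A :=
  'C(n, k)%:R * (-1) ^+ (n - k) * gen_rising lam lam (n - k).

Lemma bell_weightnn (A : comNzRingType) (lam : A) n : bell_weight lam n n = 1.
Proof. by rewrite /bell_weight binn subnn gen_rising_diag !mulr1. Qed.

Lemma bell_weightS (A : comNzRingType) (lam : A) n k : (k <= n)%N ->
  bell_weight lam n.+1 k = - (n.+1%:R * lam) * bell_weight lam n k.
Proof.
move=> le_kn; rewrite /bell_weight !gen_rising_diag subSn // factS !exprS.
have binE : 'C(n.+1, k)%:R * (n - k).+1%:R = n.+1%:R * 'C(n, k)%:R :> A.
  by rewrite -!natrM mulnC -subSn // -mul_bin_down.
rewrite natrM; set m := (n - k)%N in binE *.
transitivity (- lam * (-1) ^+ m * m`!%:R * lam ^+ m *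
              ('C(n.+1, k)%:R * m.+1%:R)); first by ring.
by rewrite binE; ring.
Qed.

Theorem theorem2p9 (R : realType) (lam : R) (hlam : lam != 0) (n : nat) :
  deg_bell lam n.+1 =
  'X * \sum_(k < n.+1)
         ('C(n, k)%:R * (-1) ^+ (n - k) * gen_rising lam lam (n - k)) *:
           ((deg_bell lam k)^`() + deg_bell lam k).
Proof.
pose F k := (deg_bell lam k)^`() + deg_bell lam k.
rewrite -[RHS]/('X * \sum_(k < n.+1) bell_weight lam n k *: F k).
elim: n => [|n IHn].
  by rewrite deg_bellS big_ord1 bell_weightnn scale1r mul0r scale0r subr0.
rewrite deg_bellS big_ord_recr /= bell_weightnn scale1r [RHS]mulrDr [RHS]addrC.
congr (_ + _); rewrite {}IHn -scaleNr scalerAr scaler_sumr; congr (_ * _).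
by apply: eq_bigr => k _; rewrite scalerA -bell_weightS // -ltnS.
Qed.
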